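(* Let $*:X^{m} \rightarrow X$ be a $k$-associative $m$-ary operation on a set $X$ where $m\geq 2$ and $k \geq 1$ are integers. Let $p(x_1*\dots*x_n)$ and $p^{\prime}(x_1 * \dots *x_n)$ be two $m$-ary parenthesizations of the $m$-ary expression $x_1*\dots*x_n$, where $n = m+g(m-1)$ for some positive integer $g$. Then $p(x_1*\dots*x_n)$ is $k$-equivalent to $p^{\prime}(x_1 * \dots *x_n)$ if and only if $$p(u_1 \circ \dots \circ u_n)= p^{\prime}(u_1 \circ \dots \circ u_n),$$ where the equality comes from evaluating the parenthesizations under $\circ$ in the algebra $A$.
   Context: An $m$-ary operation $*:X^m\to X$ is left-associative: for $g\ge 1$, $x_1*\dots*x_{m+g(m-1)}$ means $((\dots((x_1*\dots*x_m)*x_{m+1}*\dots*x_{m+(m-1)})\dots)*\dots*x_{m+g(m-1)})$, i.e. evaluated from left to right. It is $k$-associative if for $1\le j\le m-1$, $x_1*\dots*x_{j-1}*(x_j*\dots*x_{j+k(m-1)})*x_{j+k(m-1)+1}*\dots*x_{m+k(m-1)} = x_1*\dots*x_{j}*(x_{j+1}*\dots*x_{j+k(m-1)+1})*x_{j+k(m-1)+2}*\dots*x_{m+k(m-1)}$ for all elements. For parenthesizations $p,p'$ of $x_1*\dots*x_n$, write $p\preceq_k p'$ if $p'$ is obtained from $p$ by finitely many left-hand-side to right-hand-side applications of this $k$-associative identity; this is a partial order (the $k$-associative order), its connected components are the $k$-components, and two parenthesizations are $k$-equivalent if they lie in the same $k$-component. Let $A=\mathbb{C}\langle u_1,\dots,u_n\rangle$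 be the free associative algebra over $\mathbb{C}$ in $n$ indeterminates $u_1,\dots,u_n$, and let $\omega\in A$ be an element of order $k(m-1)$ (e.g. $\omega=e^{2\pi i/(k(m-1))}$). Define the (left-associative) $m$-ary operation $\circ:A^m\to A$ by $a_1\circ\dots\circ a_m=\omega^{m-1}a_1+\omega^{m-2}a_2+\dots+\omega a_{m-1}+a_m$; this operation is $k$-associative. $p(u_1\circ\dots\circ u_n)$ denotes evaluating the parenthesization $p$ with $x_i$ replaced by $u_i$ and $*$ by $\circ$. *)

(* Defs.v *)
From HB Require Import structures.
From Stdlib Require Export Relation_Operators.
From mathcomp Require Export all_boot all_algebra.
From mathcomp Require Export reals complex.
From mathcomp Require Export monalg.

Set Implicit Arguments.
Unset Strict Implicit.
Unset Printing Implicit Defensive.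

Import GRing.Theory.

Section MaryOperation.
Variables (m : nat) (X : Type) (op : {ffun 'I_m -> X} -> X).

(* x_0 * ... * x_{r(m-1)} evaluated from left to right, i.e. with r uses of
   [op]; only the first r(m-1)+1 entries of [x] matter. *)
Fixpoint left_assoc (r : nat) (x : nat -> X) : X :=
  if r is r'.+1 then
    op [ffun i : 'I_m =>
          if i == 0 :> nat then left_assoc r' x else x (r' * m.-1 + i)]
  else x 0.

(* x_0 * ... * x_{j-1} * (x_j * ... * x_{j+k(m-1)}) * x_{j+k(m-1)+1} * ...
   * x_{m+k(m-1)-1}, a single application of [op] whose argument number j
   (counted from 0) is a left-associated product. *)
Definition assoc_side (k j : nat) (x : nat -> X) : X :=
  op [ffun i : 'I_m =>
        if i < j then x i
        else if i == j :> nat then left_assoc k (fun l => x (j + l))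
        else x (k * m.-1 + i)].

Definition k_associative (k : nat) : Prop :=
  forall (j : nat) (x : nat -> X),
    j.+1 < m -> assoc_side k j x = assoc_side k j.+1 x.

End MaryOperation.

Section Terms.
Variables (m : nat) (V : Type).

Inductive term : Type :=
| Var of V
| App of {ffun 'I_m -> term}.

Fixpoint leaves (t : term) : seq V :=
  match t with
  | Var v => [:: v]
  | App f => flatten [seq leaves (f i) | i <- enum 'I_m]
  end.

Fixpoint eval (X : Type) (op : {ffun 'I_m -> X} -> X) (a : V -> X) (t : term)
    : X :=
  match t with
  | Var v => a v
  | App f => op [ffun i => eval op a (f i)]
  end.

(* One left-to-right application of the k-associative identity, with
   arbitrary terms substituted for its variables, to some subterm. *)
Inductive k_step (k : nat) : term -> term -> Prop :=
| k_step_root (j : nat) (x : nat -> term) :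
    j.+1 < m -> k_step k (assoc_side App k j x) (assoc_side App k j.+1 x)
| k_step_arg (i : 'I_m) (f f' : {ffun 'I_m -> term}) :
    k_step k (f i) (f' i) -> (forall i', i' != i -> f' i' = f i') ->
    k_step k (App f) (App f').

End Terms.

Arguments Var {m V} _.

(* The m-ary parenthesizations of x_0 * ... * x_{n-1}. *)
Record parenthesization (m n : nat) := Parenthesization {
  paren_term :> term m 'I_n;
  paren_leaves : leaves paren_term = enum 'I_n }.

(* The k-associative order. *)
Definition k_le (k m n : nat) (p p' : parenthesization m n) : Prop :=
  clos_refl_trans (term m 'I_n) (@k_step m 'I_n k) p p'.

(* Lying in the same connected component of the k-associative order. *)
Definition k_equivalent (k m n : nat) (p p' : parenthesization m n) : Prop :=
  clos_refl_sym_trans (parenthesization m n) (@k_le k m n) p p'.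

Local Open Scope ring_scope.

(* C<u_0, ..., u_{n-1}>: the monoid algebra over C = R[i] of the free monoid
   of words on n letters. *)
Definition free_algebra (R : realType) (n : nat) : nzRingType :=
  {malg R[i][{fmonom 'I_n}]}.

Definition indeterminate (R : realType) (n : nat) (i : 'I_n)
    : free_algebra R n :=
  (<< fmu i >> : {malg R[i][{fmonom 'I_n}]}).

(* omega^(m-1) a_0 + omega^(m-2) a_1 + ... + omega a_{m-2} + a_{m-1} *)
Definition circ (A : nzRingType) (omega : A) (m : nat) (a : {ffun 'I_m -> A})
    : A :=
  \sum_(i < m) omega ^+ (m - i.+1) * a i.

(* Main.v *)
Require Import Defs.
From mathcomp Require Import zify finmap.

(** Put d = m - 1. Under circ, a leaf of a parenthesization contributes
    omega ^ w times its letter, where the weight w is the sum over its branch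
    of d minus the child index. A step of the k-associative order leaves all
    weights unchanged except on the subtree moved out of argument j, where
    they drop by k d; hence weights modulo k d are invariant, and every
    component contains a tree that admits no backward step. In such a minimal
    tree every child but the first has a left spine of length < k. The spine
    starting at each leaf is determined by consecutive weights and determines
    the tree; only the root spine is not fixed by the weights modulo k d, and
    it is recovered from the number of leaves. So minimal trees with congruent
    weights coincide. Finally, u_0, ..., u_{n-1} are left linearly independent
    over A, so equal evaluations have equal powers of omega. *)

Set Implicit Arguments.
Unset Strict Implicit.
Unset Printing Implicit Defensive.

Import GRing.Theory.

(** * Weights of leaves and left spines *)

Section Code.
Variables (d : nat) (V : Type).
Local Notation T := (term d.+1 V).

(** Supplies an induction hypothesis for every child stored in the finite function. *)
Fixpoint term_nested_ind (P : T -> Prop) (PVar : forall v, P (Var v))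
    (PApp : forall f : {ffun 'I_d.+1 -> T}, (forall i, P (f i)) -> P (App f))
    (t : T) : P t :=
  match t with
  | Var v => PVar v
  | App f => PApp f (fun i => term_nested_ind PVar PApp (f i))
  end.

(* The leaves with their weights, when the whole tree sits at weight c. *)
Fixpoint code (c : nat) (t : T) : seq (V * nat) :=
  match t with
  | Var v => [:: (v, c)]
  | App f =>
      flatten [seq code (c + (d - i)) (f i) | i : 'I_d.+1 <- enum 'I_d.+1]
  end.

Fixpoint spine (t : T) : nat :=
  if t is App f then (spine (f ord0)).+1 else 0.

Fixpoint minimal (k : nat) (t : T) : bool :=
  if t is App f then
    [forall i, minimal k (f i) && ((i != ord0) ==> (spine (f i) < k))]
  else true.

Lemma unzip1_code c t : unzip1 (code c t) = leaves t.
Proof.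
elim/term_nested_ind: t c => [v|f IH] c //=.
rewrite /unzip1 map_flatten -map_comp; congr flatten.
by apply: eq_map => i; apply: IH.
Qed.

Lemma map_enum_ord n S (F : nat -> S) :
  [seq F i | i : 'I_n <- enum 'I_n] = [seq F i | i <- iota 0 n].
Proof. by rewrite -val_enum_ord -map_comp. Qed.

(** Offsets count down by one from [r * d] to 0: an outer application adds [d] throughout its first
    argument and gives the others [d - 1], ..., 0. *)
Lemma code_left_assoc r c (x : nat -> T) :
  code c (left_assoc (@App _ _) r x) =
  flatten [seq code (c + (r * d - l)) (x l) | l <- iota 0 (r * d).+1].
Proof.
elim: r c => [|r IH] c; first by rewrite /= addn0 cats0.
rewrite [LHS]/=.
under eq_map do rewrite ffunE.
rewrite (map_enum_ord _ (fun i => code (c + (d - i))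
  (if i == 0 then left_assoc (@App _ _) r x else x (r * d + i)))).
rewrite [iota 0 d.+1]/= map_cons [flatten (_ :: _)]/= IH subn0.
rewrite mulSn [d + _]addnC -addSn [in RHS]iotaD map_cat flatten_cat.
congr (_ ++ _).
  congr flatten; apply/eq_in_map => l; rewrite mem_iota => lr.
  by congr code; lia.
congr flatten; rewrite add0n -[(r * d).+1]addn1 (iotaDl (r * d)) -map_comp.
apply/eq_in_map => -[|l] //=; rewrite mem_iota => // ld.
by congr code; lia.
Qed.

(* The sides for j and j.+1 thus differ by k * d at q = j only. *)
Lemma code_assoc_side k j c (x : nat -> T) : j <= d ->
  code c (assoc_side (@App _ _) k j x) =
  flatten [seq code (c + (if q < j then d - q else k.+1 * d - q)) (x q)
          | q <- iota 0 (k.+1 * d).+1].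
Proof.
move=> jd; rewrite [LHS]/=.
under eq_map do rewrite ffunE.
rewrite (map_enum_ord _ (fun i => code (c + (d - i))
  (if i < j then x i
   else if i == j then left_assoc (@App _ _) k (fun l => x (j + l))
   else x (k * d + i)))).
(* Three blocks: the arguments before [j], the nested product, the arguments after it. *)
have -> : iota 0 d.+1 = iota 0 j ++ iota j 1 ++ iota (j + 1) (d - j).
  by rewrite -!iotaD; congr iota; lia.
have -> : (k.+1 * d).+1 = j + ((k * d).+1 + (d - j)) by lia.
rewrite !iotaD !map_cat !flatten_cat add0n; congr (_ ++ (_ ++ _)).
- by congr flatten; apply/eq_in_map => q; rewrite mem_iota => /= ->.
- rewrite [LHS]/= ltnn eqxx cats0 code_left_assoc.
  have -> : iota j (k * d).+1 = [seq j + l | l <- iota 0 (k * d).+1].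
    by rewrite -iotaDl addn0.
  rewrite -map_comp.
  congr flatten; apply/eq_in_map => l; rewrite mem_iota => /= lk.
  by rewrite ltnNge leq_addr /=; congr code; lia.
- have -> : j + (k * d).+1 = k * d + (j + 1) by lia.
  rewrite (iotaDl (k * d)) -map_comp; congr flatten; apply/eq_in_map => i.
  rewrite mem_iota => /= ij.
  have -> : (i < j) = false by lia.
  have -> : (i == j) = false by lia.
  have -> : (k * d + i < j) = false by lia.
  by congr code; lia.
Qed.


(** * Total weight as a measure for backward steps *)

Lemma size_leaves_gt0 (t : T) : 0 < size (leaves t).
Proof.
elim/term_nested_ind: t => [v|f IH] //=.
by rewrite enum_ordSl /= size_cat addn_gt0 IH.
Qed.

Definition total_weight (t : T) : nat := \sum_(u <- code 0 t) u.2.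

Lemma sum_code c t :
  \sum_(u <- code c t) u.2 = c * size (leaves t) + total_weight t.
Proof.
rewrite /total_weight; elim/term_nested_ind: t c => [v|f IH] c /=.
  by rewrite !big_seq1 muln1 addn0.
rewrite !big_flatten !big_map size_flatten /shape sumnE !big_map.
rewrite big_distrr -big_split /=; apply: eq_bigr => i _.
by rewrite IH [in RHS]IH mulnDl add0n addnA.
Qed.

Lemma size_leaves_App (f : {ffun 'I_d.+1 -> T}) :
  size (leaves (App f)) = \sum_(i < d.+1) size (leaves (f i)).
Proof. by rewrite /= size_flatten /shape sumnE !big_map. Qed.

Lemma size_leaves_child (f : {ffun 'I_d.+1 -> T}) i :
  size (leaves (f i)) + d <= size (leaves (App f)).
Proof.
rewrite size_leaves_App (bigD1 i) //= leq_add2l.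
have card_others : \sum_(j < d.+1 | j != i) 1 = d.
  by rewrite sum1_card cardC1 card_ord.
rewrite -[X in X <= _]card_others.
by apply: leq_sum => j _; apply: size_leaves_gt0.
Qed.

Lemma total_weight_App (f : {ffun 'I_d.+1 -> T}) :
  total_weight (App f) =
  \sum_(i < d.+1) ((d - i) * size (leaves (f i)) + total_weight (f i)).
Proof.
rewrite /total_weight /= big_flatten big_map big_enum /=.
by apply: eq_bigr => i _; rewrite add0n sum_code.
Qed.

(** Backward steps raise the total weight and keep the leaves, so this bound makes them terminate. A
    child with [s] leaves contributes at most [(d + s) * s], and its [d] siblings have at least one
    leaf each. *)
Lemma total_weight_le t : total_weight t <= size (leaves t) * size (leaves t).
Proof.
elim/term_nested_ind: t => [v|f IH]; first by rewrite /total_weight big_seq1.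
rewrite total_weight_App {1}size_leaves_App big_distrl; apply: leq_sum => i _.
apply: leq_trans (leq_add (leqnn _) (IH i)) _.
rewrite -mulnDl mulnC leq_mul2l; apply/orP; right.
apply: leq_trans (size_leaves_child f i).
by rewrite addnC leq_add2l leq_subr.
Qed.

(** * Weights modulo [N] and their invariance *)

Definition mod_code (N c : nat) (t : T) : seq (V * nat) :=
  [seq (u.1, u.2 %% N) | u <- code c t].

Lemma unzip1_mod_code N c t : unzip1 (mod_code N c t) = leaves t.
Proof. by rewrite /unzip1 -map_comp -(unzip1_code c). Qed.

Lemma mod_code_App N c (f : {ffun 'I_d.+1 -> T}) :
  mod_code N c (App f) =
  flatten [seq mod_code N (c + (d - i)) (f i) | i : 'I_d.+1 <- enum 'I_d.+1].
Proof. by rewrite /mod_code /= map_flatten -map_comp. Qed.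

Lemma eq_mod_code N c c' t :
  c = c' %[mod N] -> mod_code N c t = mod_code N c' t.
Proof.
elim/term_nested_ind: t c c' => [v|f IH] c c' cc'.
  by rewrite /mod_code /= cc'.
rewrite !mod_code_App; congr flatten; apply: eq_map => i.
by apply: IH; rewrite -modnDml cc' modnDml.
Qed.

Lemma mod_code_step k c (t t' : T) : k_step k t t' ->
  mod_code (k * d) c t = mod_code (k * d) c t'.
Proof.
move=> st; elim: st c => {t t'} [j x jd|i f f' _ IH ff'] c.
  rewrite /mod_code !code_assoc_side; [|lia..].
  rewrite !map_flatten -!map_comp; congr flatten; apply/eq_in_map => q _ /=.
  apply: eq_mod_code; rewrite ltnS; have [//|//|->] := ltngtP q j.
  have -> : k.+1 * d - j = k * d + (d - j) by lia.
  by rewrite addnCA modnDl.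
rewrite !mod_code_App; congr flatten; apply: eq_map => i'.
by have [->|/ff'->] := eqVneq i' i.
Qed.

Lemma mod_code_steps k c (t t' : T) : clos_refl_trans T (@k_step _ _ k) t t' ->
  mod_code (k * d) c t = mod_code (k * d) c t'.
Proof. by elim=> [? ? /mod_code_step||? ? ? _ -> _ ->]. Qed.

Lemma leaves_steps k (t t' : T) : clos_refl_trans T (@k_step _ _ k) t t' ->
  leaves t = leaves t'.
Proof.
by move=> /(mod_code_steps 0)/(congr1 unzip1); rewrite !unzip1_mod_code.
Qed.

Lemma leaves_step k (t t' : T) : k_step k t t' -> leaves t = leaves t'.
Proof.
move=> /(mod_code_step 0)/(congr1 unzip1).
by rewrite !unzip1_mod_code.
Qed.

Lemma total_weight_step k (t t' : T) : 0 < k -> 0 < d -> k_step k t t' ->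
  total_weight t' < total_weight t.
Proof.
move=> k0 d0; elim=> {t t'} [j x jd|i f f' st IH ff'].
  rewrite /total_weight !code_assoc_side; [|lia..].
  have E : forall (w : nat -> nat), \sum_(u <- flatten [seq code (0 + w q) (x q)
      | q <- iota 0 (k.+1 * d).+1]) u.2
      = \sum_(q < (k.+1 * d).+1)
          (w q * size (leaves (x q)) + total_weight (x q)).
    move=> w; rewrite big_flatten big_map -(big_mkord xpredT
      (fun q => w q * size (leaves (x q)) + total_weight (x q))).
    rewrite /index_iota subn0; apply: eq_bigr => q _; exact: sum_code.
  rewrite !E.
  have jlt : j < (k.+1 * d).+1 by rewrite mulSn; lia.
  (* The term at [j] drops strictly because [x j] has a leaf; no other term increases. *)
  rewrite (bigD1 (Ordinal jlt)) //= [X in _ < X](bigD1 (Ordinal jlt)) //=.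
  rewrite ltnn ltnSn -addSn leq_add //.
    by rewrite ltn_add2r ltn_pmul2r ?size_leaves_gt0 //; nia.
  apply: leq_sum => q /eqP/val_eqP /= qj; rewrite leq_add2r leq_mul2r.
  by rewrite ltnS [q <= j]leq_eqVlt (negbTE qj) leqnn orbT.
rewrite !total_weight_App (bigD1 i) //= [X in _ < X](bigD1 i) //= -addSn.
apply: leq_add; last by apply: leq_sum => i' /ff'->.
by rewrite (leaves_step st) -addnS leq_add2l.
Qed.

(** * Existence of minimal trees *)

Lemma left_assoc_eq r (x y : nat -> T) :
  (forall l, l <= r * d -> x l = y l) ->
  left_assoc (@App _ _) r x = left_assoc (@App _ _) r y.
Proof.
elim: r => [|r IH] xy /=; first exact: xy.
congr App; apply/ffunP => i; rewrite !ffunE; case: eqP => _.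
  by apply: IH => l lr; apply: xy; lia.
by apply: xy; have := ltn_ord i; lia.
Qed.

Lemma left_assoc_of_spine k t : k <= spine t ->
  exists x, t = left_assoc (@App _ _) k x.
Proof.
elim: k t => [|k IH] t; first by move=> _; exists (fun=> t).
case: t => [//|f] /= /IH[x fx].
(* Beyond [k * d] come the arguments 1, ..., [d] of the outermost application. *)
exists (fun l => if l <= k * d then x l else f (inord (l - k * d))).
congr App; apply/ffunP => i; rewrite ffunE; have [i0|i0] := eqVneq (i : nat) 0.
  have -> : i = ord0 by apply: val_inj.
  by rewrite fx; apply: left_assoc_eq => l ->.
have -> : (k * d + i <= k * d) = false by lia.
by rewrite addKn inord_val.
Qed.

Lemma reverse_step_of_nonminimal k t : ~~ minimal k t ->
  exists t0, k_step k t0 t.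
Proof.
elim/term_nested_ind: t => [//|f IH] /=.
move=> /forallPn[i nmin]; move: nmin; rewrite negb_and => /orP[/IH[t0 st]|].
  exists (App [ffun i' => if i' == i then t0 else f i']).
  apply: (@k_step_arg _ _ _ i); first by rewrite ffunE eqxx.
  by move=> i' /negbTE ii'; rewrite ffunE ii'.
rewrite negb_imply -leqNgt => /andP[i0 /left_assoc_of_spine[x fx]].
have {}i0 : 0 < i.
  by rewrite lt0n; apply: contraNneq i0 => i0; apply/eqP/val_inj.
have id := ltn_ord i.
(* The word [y] lists the arguments before [i], the [k * d + 1] factors of child [i], then the later
   arguments shifted by [k * d]. *)
pose y l := if l < i then f (inord l)
            else if l <= i + k * d then x (l - i) else f (inord (l - k * d)).
exists (assoc_side (@App _ _) k i.-1 y).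
have -> : App f = assoc_side (@App _ _) k i.-1.+1 y; last first.
  by apply: k_step_root; rewrite prednK.
rewrite prednK //; congr App; apply/ffunP => i'; rewrite ffunE /y.
have [i'i|i'i|i'i] := ltngtP i' i.
- by rewrite inord_val.
- have -> : (k * d + i' < i) = false by lia.
  have -> : (k * d + i' <= i + k * d) = false by lia.
  by rewrite addKn inord_val.
have -> : i' = i by apply: val_inj.
rewrite fx; apply: left_assoc_eq => l ld.
have -> : (i + l < i) = false by lia.
have -> : (i + l <= i + k * d) by lia.
by rewrite addKn.
Qed.

Lemma exists_minimal k t : 0 < k -> 0 < d ->
  exists2 t0, minimal k t0 & clos_refl_trans T (@k_step _ _ k) t0 t.
Proof.
move=> k0 d0.
(* Induction on the gap to the bound [total_weight_le], which each backward step shrinks. *)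
have [b] := ubnP (size (leaves t) * size (leaves t) - total_weight t).
elim: b t => // b IH t tb.
have [mt|/reverse_step_of_nonminimal[t0 st]] := boolP (minimal k t).
  by exists t => //; apply: rt_refl.
have [|t1 mt1 t1t0] := IH t0.
  have := total_weight_step k0 d0 st; have := total_weight_le t0.
  by move: tb; rewrite (leaves_step st); lia.
by exists t1 => //; exact: (rt_trans _ _ _ _ _ t1t0 (rt_step _ _ _ _ st)).
Qed.

(** * Uniqueness of minimal trees *)

Lemma code_head c t : exists v s, code c t = (v, c + spine t * d) :: s.
Proof.
elim/term_nested_ind: t c => [v|f IH] c; first by exists v, [::]; rewrite addn0.
have [v [s e]] := IH ord0 (c + d).
by rewrite /= enum_ordSl /= subn0 e; eexists v, _; rewrite /= mulSn addnA.
Qed.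

Lemma spine_mod N c t t' r r' :
  mod_code N c t ++ r = mod_code N c t' ++ r' ->
  spine t * d = spine t' * d %[mod N].
Proof.
have [v [s e]] := code_head c t; have [v' [s' e']] := code_head c t'.
rewrite /mod_code e e' /= => -[_ /eqP].
by rewrite eqn_modDl => /eqP.
Qed.

(** Parses the word from the left. The first weight of a child gives its spine modulo [k], hence
    exactly when it is below [k]; the first child inherits its spine from the parent. The tails [r],
    [r'] let the children be cancelled one by one. *)
Lemma minimal_prefix_inj k c t t' r r' : 0 < d ->
  minimal k t -> minimal k t' -> spine t = spine t' ->
  mod_code (k * d) c t ++ r = mod_code (k * d) c t' ++ r' -> t = t'.
Proof.
move=> d0; elim/term_nested_ind: t t' c r r' => [v|f IH] [v'|f'] c r r' //=.
  by move=> _ _ _; rewrite /mod_code /= => -[->].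
move=> /forallP mf /forallP mf' [ff'0]; rewrite !mod_code_App => E.
suff ff' : forall i, i \in enum 'I_d.+1 -> f i = f' i.
  by congr App; apply/ffunP => i; apply: ff'; rewrite mem_enum.
elim: (enum _) r r' E => // i s IHs r r'; rewrite /= -!catA => E i'.
have /andP[mi si] := mf i; have /andP[mi' si'] := mf' i.
have spi : spine (f i) = spine (f' i).
  have [->//|i0] := eqVneq i ord0.
  move: si si'; rewrite i0 /= => si si'.
  have := spine_mod E; rewrite -!muln_modl => /eqP.
  by rewrite eqn_pmul2r // !modn_small // => /eqP.
have fi := IH i _ _ _ _ mi mi' spi E.
rewrite inE => /orP[/eqP->//|]; apply: (IHs r r').
by move: E; rewrite fi; apply: List.app_inv_head.
Qed.

(* Descending e levels along the left spine; with N = k * d and k %| e the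
   offset is unchanged modulo N, which compares roots of different spines. *)
Lemma left_descent k N c s e t : minimal k t -> spine t = s + e ->
  exists t0 r, [/\ minimal k t0, spine t0 = s,
    mod_code N c t = mod_code N (c + e * d) t0 ++ r &
    size (leaves t0) + e * d <= size (leaves t)].
Proof.
elim: e c t => [|e IH] c t mt st.
  by exists t, [::]; rewrite cats0 !addn0 in st *.
case: t mt st => [|f]; first by rewrite addnS.
move=> /forallP/(_ ord0)/andP[m0 _]; rewrite addnS => -[s0].
have [t0 [r [mt0 st0 e0 l0]]] := IH (c + d) _ m0 s0.
exists t0; eexists; split=> //.
  rewrite mod_code_App enum_ordSl [flatten _]/= subn0 e0 -catA; congr (_ ++ _).
  by congr mod_code; rewrite mulSn addnA.
apply: leq_trans (size_leaves_child f ord0).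
by rewrite mulSn addnCA addnC leq_add2r.
Qed.

(** Descending in the tree of longer spine yields a subtree [t0] with the spine of [t], whose word
    is a prefix of that of [t]; so [t = t0], and counting leaves excludes a proper descent. *)
Lemma minimal_inj k t t' : 0 < d -> minimal k t -> minimal k t' ->
  mod_code (k * d) 0 t = mod_code (k * d) 0 t' -> t = t'.
Proof.
move=> d0; wlog le_tt' : t t' / spine t <= spine t'.
  move=> H mt mt' E; have [le|/ltnW le] := leqP (spine t) (spine t').
    exact: H.
  exact/esym/H.
move=> mt mt' E.
have [e st'] : exists e, spine t' = spine t + e.
  by exists (spine t' - spine t); rewrite subnKC.
have [t0 [r [mt0 st0 et0 l0]]] := left_descent (k * d) 0 mt' st'.
have e0 : 0 = e * d %[mod k * d].
  have := @spine_mod (k * d) 0 t t' [::] [::]; rewrite !cats0 => /(_ E)/eqP.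
  by rewrite st' mulnDl -[X in X == _ %[mod _]]addn0 eqn_modDl => /eqP.
have tt0 : t = t0.
  apply: (@minimal_prefix_inj k 0 t t0 [::] r) => //.
  by rewrite cats0 E et0; congr (_ ++ _); apply: eq_mod_code.
have : size (leaves t) = size (leaves t').
  by rewrite -!(unzip1_mod_code (k * d) 0) E.
move: l0; rewrite -tt0 => l0 sz; have ed : e = 0 by nia.
apply: (@minimal_prefix_inj k 0 t t' [::] [::]) => //.
  by rewrite st' ed addn0.
by rewrite E.
Qed.

Lemma steps_of_mod_code k t t' : 0 < k -> 0 < d ->
  mod_code (k * d) 0 t = mod_code (k * d) 0 t' ->
  exists t0, clos_refl_trans T (@k_step _ _ k) t0 t /\
             clos_refl_trans T (@k_step _ _ k) t0 t'.
Proof.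
move=> k0 d0 E.
have [t0 m0 s0] := exists_minimal t k0 d0.
have [t1 m1 s1] := exists_minimal t' k0 d0.
suff e01 : t0 = t1 by exists t0; rewrite {2}e01.
apply: (minimal_inj d0 m0 m1).
by rewrite (mod_code_steps 0 s0) E (mod_code_steps 0 s1).
Qed.

End Code.

(** * Evaluation under [circ] *)

Lemma unzip1_enum_ordP n (s : seq ('I_n * nat)) : unzip1 s = enum 'I_n ->
  exists w : 'I_n -> nat, s = [seq (i, w i) | i <- enum 'I_n].
Proof.
move=> s1; exists (nth 0 (unzip2 s)); rewrite -[LHS]zip_unzip s1.
have sz : size (unzip2 s) = n.
  by rewrite size_map -(size_map fst s) -/(unzip1 s) s1 size_enum_ord.
rewrite -[X in zip _ X](mkseq_nth 0) sz /mkseq -val_enum_ord -map_comp.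
by elim: (enum _) => //= i e ->.
Qed.

Local Open Scope ring_scope.

Section Circ.
Variables (d : nat) (V : Type) (A : nzRingType) (omega : A) (a : V -> A).
Local Notation T := (term d.+1 V).

(** The factor [omega ^+ c] carries the induction; powers of [omega] gather on the left, so nothing
    has to commute. *)
Lemma eval_circ c (t : T) :
  omega ^+ c * eval (@circ A omega d.+1) a t =
  \sum_(u <- code c t) omega ^+ u.2 * a u.1.
Proof.
elim/term_nested_ind: t c => [v|f IH] c /=; first by rewrite big_seq1.
rewrite big_flatten big_map big_enum mulr_sumr; apply: eq_bigr => i _ /=.
by rewrite ffunE mulrA -exprD subSS IH.
Qed.

Lemma eval_circ_mod N (t : T) : N.-primitive_root omega ->
  eval (@circ A omega d.+1) a t =
  \sum_(u <- mod_code N 0 t) omega ^+ u.2 * a u.1.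
Proof.
move=> prim; rewrite -[LHS]mul1r -(expr0 omega) eval_circ big_map.
by apply: eq_bigr => u _; rewrite prim_expr_mod.
Qed.

End Circ.

(** * Left linear independence of the letters *)

Section LastLetter.
Variables (I : finType) (S : nzRingType).
Local Notation FA := {malg S[{fmonom I}]}.

(** A nonempty word determines its last letter and the prefix before it. *)
Lemma mcoeff_mul_letter (g : FA) (w : {fmonom I}) (i j : I) :
  (g * << fmu i >>)@_(fmmul w (fmu j)) = g@_w *+ (i == j).
Proof.
have rc (w1 w2 : {fmonom I}) i1 i2 :
    (fmmul w1 (fmu i1) == fmmul w2 (fmu i2)) = (w1 == w2) && (i1 == i2).
  by rewrite -!val_eqE /= !fmmulE !fmuE /= !cats1 eqseq_rcons.
rewrite (@mcoeffMlw _ _ (msupp g) [fset fmu i]%fset) //; last exact: msuppU_le.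
rewrite [in RHS](monalgE g) raddf_sum /= -sumrMnl; apply: eq_bigr => k _.
rewrite big_seq_fset1 mcoeffUU mulr1 mcoeffU -mulrnA mulnb.
by rewrite [_ == fmmul w _](rc k w i j) mulrb; case: (_ && _).
Qed.

Lemma sum_letters_inj (y z : I -> FA) :
  \sum_(i <- enum I) y i * << fmu i >> = \sum_(i <- enum I) z i * << fmu i >> ->
  y =1 z.
Proof.
have coef (x : I -> FA) j w :
    (\sum_(i <- enum I) x i * << fmu i >>)@_(fmmul w (fmu j)) = (x j)@_w.
  rewrite big_enum raddf_sum (bigD1 j) //= mcoeff_mul_letter eqxx mulr1n.
  by rewrite big1 ?addr0 // => i /negbTE ij; rewrite mcoeff_mul_letter ij.
by move=> E j; apply/malgP => w; rewrite -!coef E.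
Qed.

End LastLetter.

(** * From evaluations back to weights, and the equivalence *)

Lemma mod_code_eval (R : realType) d n N (omega : free_algebra R n)
    (p p' : parenthesization d.+1 n) : N.-primitive_root omega ->
  eval (@circ (free_algebra R n) omega d.+1) (@indeterminate R n) p =
  eval (@circ (free_algebra R n) omega d.+1) (@indeterminate R n) p' ->
  mod_code N 0 p = mod_code N 0 p'.
Proof.
move=> prim.
rewrite -[LHS]mul1r -[RHS]mul1r -(expr0 omega) !eval_circ /mod_code.
(* Each letter occurs exactly once, in order, so a code amounts to a weight function on letters. *)
have [w ->] := unzip1_enum_ordP (etrans (unzip1_code 0 p) (paren_leaves p)).
have [w' ->] := unzip1_enum_ordP (etrans (unzip1_code 0 p') (paren_leaves p')).
rewrite big_map [in RHS]big_map => /sum_letters_inj E.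
rewrite -!map_comp; apply: eq_map => i /=; congr pair; apply/eqP.
by rewrite -(eq_prim_root_expr prim) E.
Qed.

Theorem theorem1p1 (R : realType) (m k g n : nat)
  (hm : (2 <= m)%N) (hk : (1 <= k)%N) (hg : (0 < g)%N)
  (hn : n = (m + g * (m - 1))%N)
  (X : Type) (star : {ffun 'I_m -> X} -> X) (hstar : k_associative star k)
  (omega : free_algebra R n)
  (homega : (k * (m - 1))%N.-primitive_root omega)
  (p p' : parenthesization m n) :
  k_equivalent k p p' <->
  eval (@circ (free_algebra R n) omega m) (@indeterminate R n) p =
  eval (@circ (free_algebra R n) omega m) (@indeterminate R n) p'.
Proof.
clear hn star hstar.
case: m hm omega homega p p' => [|d] //; rewrite ltnS subn1 /= => d0.
move=> omega prim p p'; split.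
  rewrite !(eval_circ_mod _ _ prim).
  suff: k_equivalent k p p' -> mod_code (k * d) 0 p = mod_code (k * d) 0 p'.
    by move=> H /H ->.
  by elim=> {p p'} [p p' /mod_code_steps||p p' _ ->|p q p' _ -> _ ->].
move=> /(mod_code_eval prim)/(steps_of_mod_code hk d0)[t0 [s s']].
(* The common lower bound has the same leaves as [p], hence is itself a parenthesization. *)
pose q := Parenthesization (etrans (leaves_steps s) (paren_leaves p)).
have qp : k_le k q p by [].
have qp' : k_le k q p' by [].
apply: (rst_trans _ _ _ q); last exact: rst_step.
by apply: rst_sym; apply: rst_step.
Qed.
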